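(* For every integer $m \ge 2$, $d(m, 4m) \le 409$.
   Context: An integral point set in $\mathbb{R}^m$ is a finite set $\mathcal{P}$ of points of the $m$-dimensional Euclidean space $\mathbb{R}^m$ such that the Euclidean distance between any two points of $\mathcal{P}$ is an integer and $\mathcal{P}$ is not contained in an $(m-1)$-dimensional (affine) hyperplane. Its diameter is $\operatorname{diam}(\mathcal{P}) = \max_{P_1, P_2 \in \mathcal{P}} |P_1P_2|$. The function $d(m,n)$ is the minimal possible diameter of an integral point set of $n$ points in $\mathbb{R}^m$. *)

(* Defs.v *)
From HB Require Import structures.
From mathcomp Require Import all_boot all_order all_algebra.
From mathcomp Require Import finmap.
From mathcomp Require Import reals.

Set Implicit Arguments.
Unset Strict Implicit.
Unset Printing Implicit Defensive.

Import Order.TTheory GRing.Theory Num.Theory.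
Local Open Scope ring_scope.
Local Open Scope fset_scope.

(* The norm that MathComp-Analysis puts on row vectors is the sup norm, so the
   Euclidean distance is written out. *)
Definition edist (R : realType) (m : nat) (x y : 'rV[R]_m) : R :=
  Num.sqrt (\sum_(i < m) (x ord0 i - y ord0 i) ^+ 2).

(* The hyperplane is the coset p + V; writing its dimension as
   (\dim V).+1 = m avoids the truncated predecessor at m = 0. *)
Definition in_hyperplane (R : realType) (m : nat) (P : {fset 'rV[R]_m}) : Prop :=
  exists (p : 'rV[R]_m) (V : {vspace 'rV[R]_m}),
    (\dim V).+1 = m /\ (forall x, x \in P -> x - p \in V).

Definition integral_point_set (R : realType) (m : nat)
    (P : {fset 'rV[R]_m}) : Prop :=
  (forall x y, x \in P -> y \in P -> edist x y \is a Num.int) /\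
  ~ in_hyperplane P.

(* Distances are nonnegative, so the default value 0 does not affect the
   maximum when P is nonempty. *)
Definition diam (R : realType) (m : nat) (P : {fset 'rV[R]_m}) : R :=
  \big[Num.max/0]_(x <- P) \big[Num.max/0]_(y <- P) edist x y.

(* d(m, n) as a relation: d is the least element of the set of diameters of
   integral point sets of n points in R^m.  A least element is unique, and it
   exists only when there is at least one such point set. *)
Definition is_min_diam (R : realType) (m n : nat) (d : R) : Prop :=
  (exists P : {fset 'rV[R]_m},
     [/\ integral_point_set P, #|` P| = n & diam P = d]) /\
  (forall P : {fset 'rV[R]_m},
     integral_point_set P -> #|` P| = n -> d <= diam P).

(* Main.v *)
Require Import Defs.
From HB Require Import structures.
From mathcomp Require Import all_boot all_order all_algebra.
From mathcomp Require Import finmap.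
From mathcomp Require Import boolp reals ring.

Set Implicit Arguments.
Unset Strict Implicit.
Unset Printing Implicit Defensive.

Import Order.TTheory GRing.Theory Num.Theory.
Local Open Scope ring_scope.

(** The point set is a prism over a regular (m-1)-simplex of side 120, with four
    points at heights 0, 182, 209 and 391 above every vertex.  The height
    differences are 27, 182, 209 and 391, and each of them is a leg of a
    Pythagorean triangle whose other leg is 120; the hypotenuses are 123, 218,
    241 and 409.  Diameters of integral point sets are natural numbers, so the
    minimum defining d(m, 4m) is attained. *)

Lemma edist_ge0 (R : realType) (m : nat) (x y : 'rV[R]_m) : 0 <= edist x y.
Proof. exact: sqrtr_ge0. Qed.

Lemma diam_nat (R : realType) (m : nat) (P : {fset 'rV[R]_m}) :
  integral_point_set P -> diam P \is a Num.nat.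
Proof.
move=> [intP _]; rewrite /diam big_seq.
have max_nat (u v : R) :
    u \is a Num.nat -> v \is a Num.nat -> Num.max u v \is a Num.nat.
  by rewrite maxEle; case: ifP.
apply: (big_ind (fun v : R => v \is a Num.nat)) => // x xP.
rewrite big_seq; apply: (big_ind (fun v : R => v \is a Num.nat)) => // y yP.
by rewrite natrEint intP // edist_ge0.
Qed.

Lemma is_min_diam_le (R : realType) (m n : nat) (P : {fset 'rV[R]_m}) :
  integral_point_set P -> #|` P| = n ->
  exists d : R, is_min_diam m n d /\ d <= diam P.
Proof.
move=> ipsP cardP.
(* Classical reflection makes this a boolean predicate on naturals, as [ex_minnP] requires; [P]
   itself witnesses that it is satisfiable. *)
pose Q k := `[< exists P' : {fset 'rV[R]_m},
  [/\ integral_point_set P', #|` P'| = n & diam P' = k%:R] >].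
have exQ : exists k, Q k.
  have /natrP[k Dk] := diam_nat ipsP.
  by exists k; apply/asboolP; exists P.
case: (ex_minnP exQ) => k /asboolP Qk mink.
have le_diam (P' : {fset 'rV[R]_m}) :
    integral_point_set P' -> #|` P'| = n -> k%:R <= diam P'.
  move=> ipsP' cardP'; have /natrP[j Dj] := diam_nat ipsP'.
  by rewrite Dj ler_nat; apply: mink; apply/asboolP; exists P'.
by exists k%:R; split; [split | exact: le_diam].
Qed.

(* The vectors [(a / sqrt 2) e_i] are the vertices of a regular simplex of side
   [a], whose edges are orthogonal to the unit vector [(1, ..., 1) / sqrt m]. *)
Definition prism_point (R : realType) (m : nat) (a : R) (i : 'I_m) (t : R) :
    'rV[R]_m :=
  \row_j (a / Num.sqrt 2 * (i == j)%:R + t / Num.sqrt m%:R).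

(** Pythagoras: the two points differ by a multiple of [e_i - e_j] plus a multiple of the all-ones
    vector, and these are orthogonal because the coordinates of [e_i - e_j] sum to 0. *)
Lemma edist_prism (R : realType) (m : nat) (a s t : R) (i j : 'I_m) :
  edist (prism_point a i s) (prism_point a j t) =
  Num.sqrt ((i != j)%:R * a ^+ 2 + (s - t) ^+ 2).
Proof.
rewrite /edist; congr Num.sqrt.
set c := a / Num.sqrt 2; set b := (Num.sqrt m%:R)^-1 : R.
have c2 : 2 * c ^+ 2 = a ^+ 2.
  by rewrite /c exprMn exprVn sqr_sqrtr // mulrCA mulfV ?mulr1 // pnatr_eq0.
have b2 : m%:R * b ^+ 2 = 1.
  rewrite exprVn sqr_sqrtr ?ler0n // mulfV // pnatr_eq0.
  (* The index [i] rules out [m = 0]. *)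
  by case: (m) i {j b} => // -[].
have sumd (k : 'I_m) : \sum_(l < m) (k == l)%:R = 1 :> R.
  rewrite (bigD1 k) //= eqxx big1 ?addr0 // => l.
  by rewrite eq_sym => /negbTE->.
(* Indicators are idempotent; those of [i] and [j] have disjoint supports if [i != j] and cancel
   otherwise. Each squared coordinate is thus affine in them. *)
transitivity (\sum_(l < m) ((c ^+ 2 * (i != j)%:R) * ((i == l)%:R + (j == l)%:R)
   + 2 * c * b * (s - t) * ((i == l)%:R - (j == l)%:R)
   + (b * (s - t)) ^+ 2)).
  apply: eq_bigr => l _; rewrite !mxE -/c -/b.
  have [<-|ij] := eqVneq i j; first by rewrite /=; ring.
  case: (eqVneq i l) (eqVneq j l) => [il|_] [jl|_] /=; try ring.
  by rewrite il jl eqxx in ij.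
rewrite big_split /= sumr_const card_ord -[_ *+ m]mulr_natl -c2.
rewrite big_split /= -!mulr_sumr !big_split /= sumrN !sumd subrr mulr0 addr0.
by rewrite -[X in _ = _ + X]mul1r -[X in _ = _ + X * _]b2; ring.
Qed.

(** A vertical pair of points puts the all-ones vector in the direction [V], and a horizontal pair
    puts [e_i - e_j] there. Together these span the whole space, whereas [V] has dimension
    [m - 1]. *)
Lemma prism_not_in_hyperplane (R : realType) (m : nat) (a s t : R)
    (P : {fset 'rV[R]_m}) :
  a != 0 -> s != t ->
  (forall i, prism_point a i s \in P /\ prism_point a i t \in P) ->
  ~ in_hyperplane P.
Proof.
move=> a0 st inP [p [V [dimV subV]]].
have m0 : (0 < m)%N by rewrite -dimV.
have diffV x y : x \in P -> y \in P -> x - y \in V.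
  by move=> xP yP; rewrite -[x](subrK p) -addrA -[p - y]opprB rpredB ?subV.
have oneV : const_mx 1 \in V.
  have := diffV _ _ (inP (Ordinal m0)).1 (inP (Ordinal m0)).2.
  have -> : prism_point a (Ordinal m0) s - prism_point a (Ordinal m0) t =
            ((s - t) / Num.sqrt m%:R) *: const_mx 1.
    by apply/rowP => l; rewrite !mxE; ring.
  rewrite rpredZeq mulf_eq0 invr_eq0 sqrtr_eq0 subr_eq0 (negbTE st).
  by rewrite leNgt ltr0n m0.
have deltaBV i j : delta_mx 0 i - delta_mx 0 j \in V.
  have := diffV _ _ (inP i).1 (inP j).1.
  have -> : prism_point a i s - prism_point a j s =
            (a / Num.sqrt 2) *: (delta_mx 0 i - delta_mx 0 j).
    by apply/rowP => l; rewrite !mxE eqxx /= ![l == _]eq_sym; ring.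
  by rewrite rpredZeq mulf_eq0 invr_eq0 sqrtr_eq0 (negbTE a0) leNgt ltr0n.
have deltaV j : delta_mx 0 j \in V.
  (* Summing [e_i - e_j] over [i] gives the all-ones vector minus [m e_j], and [m] is invertible. *)
  have mV : m%:R *: delta_mx 0 j \in V.
    have -> : m%:R *: delta_mx 0 j =
        const_mx 1 - \sum_(i < m) (delta_mx 0 i - delta_mx 0 j) :> 'rV[R]_m.
      rewrite sumrB sumr_const card_ord scaler_nat opprB addrCA.
      rewrite [X in _ - X](_ : _ = const_mx 1) ?subrr ?addr0 //.
      by rewrite [RHS]row_sum_delta; apply: eq_bigr => i _; rewrite mxE scale1r.
    by rewrite rpredB ?rpred_sum.
  by move: mV; rewrite rpredZeq pnatr_eq0 eqn0Ngt m0.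
have fullV : (fullv <= V)%VS.
  apply/subvP => u _; rewrite (row_sum_delta u).
  by rewrite rpred_sum // => j _; rewrite rpredZ.
by have := dimvS fullV; rewrite dimvf /dim /= mul1n -[X in (X <= _)%N]dimV ltnn.
Qed.

(** The symmetry [t -> 391 - t] is why six pairs of heights give only four differences. *)
Definition heights : 4.-tuple nat := [tuple 0; 182; 209; 391]%N.

Lemma heights_pythagorean (R : realType) (b : bool) (k l : 'I_4) :
  exists2 n : nat, (n <= 409)%N &
    b%:R * 120 ^+ 2 + ((tnth heights k)%:R - (tnth heights l)%:R) ^+ 2
    = n%:R ^+ 2 :> R.
Proof.
(* [b] tells whether the base vertices differ. If so, the difference 0 gives a base edge 120 and the
   others give hypotenuses. *)
pose hypot d := (if b
  then nth 0 [:: 120; 123; 218; 241; 409] (index d [:: 0; 27; 182; 209; 391])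
  else d)%N.
(* The argument of [hypot] is [|h k - h l|], as subtraction is truncated. *)
pose h := tnth heights; exists (hypot ((h k - h l) + (h l - h k)))%N.
  rewrite {}/hypot {}/h; case: b;
  by case: k l => [[|[|[|[|//]]]] ?] [[|[|[|[|//]]]] ?].
rewrite {}/hypot {}/h; case: b;
  case: k l => [[|[|[|[|//]]]] ?] [[|[|[|[|//]]]] ?];
  rewrite !(tnth_nth 0%N) /subn /addn /=; ring.
Qed.

Theorem mainTheorem4 (R : realType) (m : nat) (hm : (2 <= m)%N) :
  exists d : R, is_min_diam m (4 * m) d /\ d <= 409.
Proof.
pose h (k : 'I_4) : R := (tnth heights k)%:R.
pose f (x : 'I_m * 'I_4) := prism_point 120 x.1 (h x.2).
pose P := [fset f x | x in {: 'I_m * 'I_4}]%fset.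
have distP x y : exists2 n : nat, (n <= 409)%N & edist (f x) (f y) = n%:R.
  have [n n409 Dn] := heights_pythagorean R (x.1 != y.1) x.2 y.2.
  by exists n => //; rewrite edist_prism Dn sqrtr_sqr ger0_norm.
have fP x : f x \in P by apply: in_imfset.
(* At distance 0 both terms of the distance formula vanish: the first forces equal vertices, the
   second equal heights. *)
have f_inj : injective f.
  move=> [i k] [j l] fE; have : edist (f (i, k)) (f (j, l)) = 0.
    by rewrite fE /edist big1 ?sqrtr0 // => u _; rewrite subrr expr0n.
  move/eqP; rewrite edist_prism sqrtr_eq0 /= => d0.
  have ij : i = j.
    apply: contraTeq d0 => ->; rewrite -ltNge mul1r.
    by rewrite ltr_wpDr ?sqr_ge0 // exprn_gt0 // ltr0n.
  move: d0; rewrite ij eqxx mul0r add0r => d0.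
  have : (h k - h l) ^+ 2 == 0 by rewrite eq_le d0 sqr_ge0.
  rewrite sqrf_eq0 subr_eq0 eqr_nat => /eqP kl.
  by congr (_, _); apply: (tuple_uniqP heights _) kl.
have ipsP : integral_point_set P.
  split.
    move=> _ _ /imfsetP[x _ ->] /imfsetP[y _ ->].
    by have [n _ ->] := distP x y; rewrite natr_int.
  apply: (@prism_not_in_hyperplane _ _ 120 (h 0) (h 1)) => [||i].
  - by rewrite pnatr_eq0.
  - by rewrite /h eqr_nat !(tnth_nth 0%N).
  - by split; [apply: (fP (i, 0)) | apply: (fP (i, 1))].
have cardP : #|` P| = (4 * m)%N.
  by rewrite card_imfset //= -cardE card_prod !card_ord mulnC.
have [d [dmin dP]] := is_min_diam_le ipsP cardP.
exists d; split=> //; apply: le_trans dP _.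
rewrite /diam big_seq; apply: bigmax_le => // _ /imfsetP[x _ ->].
rewrite big_seq; apply: bigmax_le => // _ /imfsetP[y _ ->].
by have [n n409 ->] := distP x y; rewrite ler_nat.
Qed.
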